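(* Let $k$ be a positive integer. Suppose that on a closed interval $\mathbf{I}\subseteq\mathbb{R}$ we have $x_1\in\mathbf{I},\ x_2\in\mathbf{I},\ \dots,\ x_k\in\mathbf{I}$ and $x\in\mathbf{I}$, that $x_1,\dots,x_k$ are different from one another, and that $p_{k1},p_{k2},\dots,p_{k(k+1)}$ are functions of $x$. Consider the function value problem of order $k$: $$y^{(k)}=p_{k1}y^{(k-1)}+p_{k2}y^{(k-2)}+\cdots+p_{k(k-1)}y'+p_{kk}y+p_{k(k+1)},$$ $$y|_{x=x_1}=y(x_1),\quad y|_{x=x_2}=y(x_2),\quad\dots,\quad y|_{x=x_k}=y(x_k),$$ where the values $y(x_1),\dots,y(x_k)$ are prescribed. Assume that the solution $y=y(x)$ of this problem and $p_{k1},\dots,p_{k(k+1)}$ have derivatives of arbitrary order on $\mathbf{I}$, that $$\lim_{n\to\infty}\frac{1}{n!}\int_{x_i}^{x}(x_i-t)^n\,y^{(n+1)}(t)\,dt=0\qquad(i=1,2,\dots,k),$$ and that $Q_{(k-1)1}\neq 0,\ Q_{(k-2)1}\neq 0,\ \dots,\ Q_{01}\neq 0$, where the $Q$'s are the functions defined in the context. Then, by the construction described in the context, the function value problem of order $k$ becomes the following function value problem of order $k-1$: $$y^{(k-1)}=p_{(k-1)1}y^{(k-2)}+p_{(k-1)2}y^{(k-3)}+\cdots+p_{(k-1)(k-2)}y'+p_{(k-1)(k-1)}y+p_{(k-1)k},$$ $$y|_{x=x_1}=y(x_1),\quad y|_{x=x_2}=y(x_2),\quad\dots,\quad y|_{x=x_{k-1}}=y(x_{k-1}),$$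 where $p_{(k-1)i}=-Q_{(k-1)(i+1)}/Q_{(k-1)1}$ for $i=1,\dots,k$.
   Context: The functions $Q$ and the reduced coefficients are constructed successively for $j=k,k-1,\dots,1$. Suppose that the linear equation of order $j$, $$y^{(j)}=p_{j1}y^{(j-1)}+\cdots+p_{j(j-1)}y'+p_{jj}y+p_{j(j+1)},$$ is given (for $j=k$ it is the original equation). (1) Functions $p^{[j]}_{n,i}$, for $n\ge j$ and $1\le i\le j+1$, are defined by $p^{[j]}_{j,i}=p_{ji}$ and, for $n=j+1,j+2,\dots$, $$p^{[j]}_{n,i}=\bigl(p^{[j]}_{n-1,i}\bigr)'+p^{[j]}_{n-1,1}\,p_{ji}+p^{[j]}_{n-1,i+1}\quad(1\le i\le j-1),$$ $$p^{[j]}_{n,i}=\bigl(p^{[j]}_{n-1,i}\bigr)'+p^{[j]}_{n-1,1}\,p_{ji}\quad(i=j,\ j+1).$$ They are the coefficients in the formula obtained by differentiating the equation repeatedly, $y^{(n)}=p^{[j]}_{n,1}y^{(j-1)}+\cdots+p^{[j]}_{n,j-1}y'+p^{[j]}_{n,j}y+p^{[j]}_{n,j+1}$. (2) Substituting this formula for all $n\ge j$, together with the condition $y|_{x=x_j}=y(x_j)$, into the expansion $$\sum_{n=1}^{\infty}(-1)^n\frac{(x-x_j)^n}{n!}y^{(n)}+y-y(x_j)=0$$ and collecting terms gives $$Q_{(j-1)1}y^{(j-1)}+Q_{(j-1)2}y^{(j-2)}+\cdots+Q_{(j-1)(j-1)}y'+Q_{(j-1)j}y+Q_{(j-1)(j+1)}=0,$$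 where $$Q_{(j-1)i}=\sum_{n=j}^{\infty}(-1)^n\frac{(x-x_j)^n}{n!}p^{[j]}_{n,i}+(-1)^{j-i}\frac{(x-x_j)^{j-i}}{(j-i)!}\quad(1\le i\le j),$$ with $(x-x_j)^0=1$, and $$Q_{(j-1)(j+1)}=\sum_{n=j}^{\infty}(-1)^n\frac{(x-x_j)^n}{n!}p^{[j]}_{n,j+1}-y(x_j).$$ (3) When $Q_{(j-1)1}\neq0$, the coefficients of the equation of order $j-1$ are $$p_{(j-1)i}=-\frac{Q_{(j-1)(i+1)}}{Q_{(j-1)1}}\qquad(1\le i\le j).$$ For $j=1$ the resulting equation of order $0$ is $y=p_{01}=-Q_{02}/Q_{01}$. *)

(* Defs.v *)
From HB Require Import structures.
From mathcomp Require Import all_boot all_order all_algebra.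
From mathcomp Require Import all_classical all_reals all_analysis.
Set Implicit Arguments.
Unset Strict Implicit.
Unset Printing Implicit Defensive.
Import Order.TTheory GRing.Theory Num.Theory.
Import numFieldNormedType.Exports.
Local Open Scope classical_set_scope.
Local Open Scope ring_scope.

(* Derivatives are taken along the interval I, hence one-sided at an endpoint
   of I; at a point of I they only depend on the values of f on I. *)
Definition diff_quotient (R : realType) (f : R -> R) (x z : R) : R :=
  (f z - f x) / (z - x).

Definition derivable_along (R : realType) (I : set R) (f : R -> R) (x : R) :
    Prop :=
  cvg (diff_quotient f x z @[z --> within I x^']).

Definition derive_along (R : realType) (I : set R) (f : R -> R) : R -> R :=
  fun x => lim (diff_quotient f x z @[z --> within I x^']).

Definition deriven_along (R : realType) (I : set R) (n : nat) (f : R -> R) :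
    R -> R :=
  iter n (derive_along I) f.

Definition derivablen_on (R : realType) (I : set R) (n : nat) (f : R -> R) :
    Prop :=
  forall m, (m < n)%N ->
  forall x, I x -> derivable_along I (deriven_along I m f) x.

Definition smooth_on (R : realType) (I : set R) (f : R -> R) : Prop :=
  forall n, derivablen_on I n f.

(* The oriented integral, from a to b. *)
Definition oriented_integral (R : realType) (a b : R) (f : R -> R) : R :=
  if a <= b then \int[@lebesgue_measure R]_(t in `[a, b]) f t
  else - \int[@lebesgue_measure R]_(t in `[b, a]) f t.

(* Throughout, indices are those of the mathematical text: the coefficients of
   an equation of order j are p 1, ..., p j.+1, and the points and prescribed
   values are a 1, ..., a k and c 1, ..., c k; other indices are irrelevant. *)

(* The equation is required at the points of E only (the coefficients may be
   singular at some points of I), while y is differentiated along I. *)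
Definition fvp_solution (R : realType) (I E : set R) (j : nat)
    (p : nat -> R -> R) (a c : nat -> R) (y : R -> R) : Prop :=
  [/\ derivablen_on I j y,
      forall x, E x ->
        deriven_along I j y x =
        \sum_(1 <= i < j.+1) p i x * deriven_along I (j - i) y x + p j.+1 x
    & forall i, (1 <= i <= j)%N -> y (a i) = c i].

(* diff_coef I j p m i is p^[j]_{j+m,i}, where p is the family p_{j1}, ... *)
Fixpoint diff_coef (R : realType) (I : set R) (j : nat) (p : nat -> R -> R)
    (m i : nat) : R -> R :=
  if m is m'.+1 then
    fun x => derive_along I (diff_coef I j p m' i) x
             + diff_coef I j p m' 1 x * p i x
             + (if (i < j)%N then diff_coef I j p m' i.+1 x else 0)
  else p i.

(* N-th partial sum of \sum_(n >= j) (-1)^n (x - xj)^n / n! p^[j]_{n,i}(x). *)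
Definition Q_partial_sum (R : realType) (I : set R) (j : nat)
    (p : nat -> R -> R) (xj : R) (i : nat) (x : R) (N : nat) : R :=
  \sum_(j <= n < N)
     (-1) ^+ n * ((x - xj) ^+ n / n`!%:R) * diff_coef I j p (n - j) i x.

(* Q_{(j-1)i}, for an equation of order j with coefficients p and the
   condition y(xj) = cj. *)
Definition Q_of (R : realType) (I : set R) (j : nat) (p : nat -> R -> R)
    (xj cj : R) (i : nat) (x : R) : R :=
  limn (Q_partial_sum I j p xj i x)
  + (if (i <= j)%N then (-1) ^+ (j - i) * ((x - xj) ^+ (j - i) / (j - i)`!%:R)
     else - cj).

(* The coefficients of the equation of order k - m obtained after m steps; the
   step from order k - m to k - m.+1 uses the point and value of index k - m. *)
Fixpoint coef_after (R : realType) (I : set R) (k : nat) (a c : nat -> R)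
    (p : nat -> R -> R) (m : nat) : nat -> R -> R :=
  if m is m'.+1 then
    let j := (k - m')%N in
    let Q := Q_of I j (coef_after I k a c p m') (a j) (c j) in
    fun i x => - (Q i.+1 x / Q 1%N x)
  else p.

(* p_{ji} and Q_{ji}, as obtained from the equation of order k. *)
Definition reduced_coef (R : realType) (I : set R) (k : nat) (a c : nat -> R)
    (p : nat -> R -> R) (j : nat) : nat -> R -> R :=
  coef_after I k a c p (k - j).

Definition Q_coef (R : realType) (I : set R) (k : nat) (a c : nat -> R)
    (p : nat -> R -> R) (j : nat) : nat -> R -> R :=
  Q_of I j.+1 (reduced_coef I k a c p j.+1) (a j.+1) (c j.+1).

(* Main.v *)
Require Import Defs.
From HB Require Import structures.
From mathcomp Require Import all_boot all_order all_algebra.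
From mathcomp Require Import all_classical all_reals all_analysis.
From mathcomp Require Import ring.
Import Order.TTheory GRing.Theory Num.Theory.
Import numFieldNormedType.Exports.
Local Open Scope classical_set_scope.
Local Open Scope ring_scope.

(* For n >= k the coefficients p^[k]_{n,i} express y^(n) on all of I in terms of
   y, ..., y^(k-1).  Since d/dt of sum_{n <= N} (a - t)^n / n! y^(n)(t)
   telescopes to (a - t)^N / N! y^(N+1)(t), the integral hypothesis says exactly
   that the Taylor series of y based at x and evaluated at a = x_k converges to
   y(x_k).  Splitting that series at n = k and inserting the formula for y^(n)
   yields a linear relation between y, ..., y^(k-1) at x with coefficients
   Q_{(k-1)i}, which is solved for y^(k-1). *)

(** Relational form of [derive_along]: the rules of calculus can be proved as limits, and [lim] is
    evaluated only afterwards, by [derive_alongE]. *)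
Definition is_derive_along {R : realType} (I : set R) (f : R -> R) (x l : R) :
    Prop :=
  diff_quotient f x z @[z --> within I x^'] --> l.

(** * Differential calculus along a set *)

Section DeriveAlong.
Set Implicit Arguments.
Unset Strict Implicit.
Variables (R : realType) (I : set R).
Implicit Types (f g : R -> R) (x l : R).

(** A nondegenerate interval accumulates at each of its points. This makes limits along it unique,
    so that [derive_along] can be computed. *)
Lemma within_dnbhs_proper (I_itv : is_interval I)
    (I_nondeg : exists u v : R, [/\ I u, I v & u < v]) x :
  I x -> ProperFilter (within I x^').
Proof.
move=> Ix; apply: Build_ProperFilter_ex => P.
rewrite /within /dnbhs /within /= => /nbhs_ballP[e /= e0 eP].
have [u [v [Iu Iv uv]]] := I_nondeg.
(* There is room in [I] to the right of [x] if [x < v], and otherwise to the left, as [u < v <= x].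
   The step [d] is capped by [e / 2] to stay in the ball and by the distance to [v] or [u] to stay
   in [I]. *)
have [xv|vx] := ltP x v.
  pose d := Num.min (e / 2) (v - x).
  have d0 : 0 < d by rewrite lt_min divr_gt0//= subr_gt0.
  have de : d < e by rewrite gt_min ltr_pdivrMr// ltr_pMr// ltr1n.
  have dv : x + d <= v by rewrite -lerBrDl ge_min lexx orbT.
  exists (x + d); apply: eP.
  - by rewrite /ball /= opprD addrA subrr sub0r normrN gtr0_norm.
  - by rewrite -subr_eq0 addrC addKr gt_eqF.
  - by apply: (I_itv x v) => //; rewrite lerDl (ltW d0).
have ux : u < x by exact: lt_le_trans vx.
pose d := Num.min (e / 2) (x - u).
have d0 : 0 < d by rewrite lt_min divr_gt0//= subr_gt0.
have de : d < e by rewrite gt_min ltr_pdivrMr// ltr_pMr// ltr1n.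
have dv : u <= x - d by rewrite lerBrDr -lerBrDl ge_min lexx orbT.
exists (x - d); apply: eP.
- by rewrite /ball /= opprB addrC subrK gtr0_norm.
- by rewrite -subr_eq0 addrC addKr oppr_eq0 gt_eqF.
- by apply: (I_itv u x) => //; rewrite dv gerBl (ltW d0).
Qed.

Lemma near_within_dnbhs x : \forall z \near within I x^', I z /\ z != x.
Proof.
rewrite near_withinE; near=> z => Iz; split => //.
by near: z; exact: nbhs_dnbhs_neq.
Unshelve. all: by end_near. Qed.

Lemma is_derive_along_derivable f x l :
  is_derive_along I f x l -> derivable_along I f x.
Proof. by move=> fl; apply: (cvgP l). Qed.

Lemma is_derive_along_eq f g x l : I x -> (forall z, I z -> f z = g z) ->
  is_derive_along I f x l -> is_derive_along I g x l.
Proof.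
move=> Ix fg; apply: cvg_trans; apply: near_eq_cvg.
apply: filterS (near_within_dnbhs x) => z [Iz _].
by rewrite /diff_quotient !fg.
Qed.

Lemma is_derive_along_cst c x : is_derive_along I (fun=> c) x 0.
Proof.
by rewrite /is_derive_along /diff_quotient subrr;
  under eq_cvg do rewrite mul0r; exact: cvg_cst.
Qed.

Lemma is_derive_along_id x : is_derive_along I id x 1.
Proof.
apply: cvg_near_cst; apply: filterS (near_within_dnbhs x) => z [_ zx].
by rewrite /diff_quotient divff// subr_eq0.
Qed.

Lemma is_derive_alongD f g x l m : is_derive_along I f x l ->
  is_derive_along I g x m ->
  is_derive_along I (fun z => f z + g z) x (l + m).
Proof.
move=> fl gm; apply: cvg_trans (cvgD fl gm); apply: near_eq_cvg; near=> z.
by rewrite /diff_quotient !fctE; ring.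
Unshelve. all: by end_near. Qed.

(** Away from [x], [f z] is [f x] plus the difference quotient times [z - x], and this product tends
    to [l * 0]. *)
Lemma is_derive_along_continuous f x l : is_derive_along I f x l ->
  f z @[z --> within I (nbhs x)] --> f x.
Proof.
move=> fl.
have h : f z @[z --> within I x^'] --> f x.
  have zx : z - x @[z --> within I x^'] --> (0 : R).
    rewrite -[X in _ --> X](subrr x); apply: cvgB; last exact: cvg_cst.
    exact: cvg_trans (cvg_within _) (@nbhs_dnbhs _ x).
  have : f x + diff_quotient f x z * (z - x) @[z --> within I x^'] -->
      f x + l * 0 by apply: cvgD; [exact: cvg_cst|exact: cvgM fl zx].
  rewrite mulr0 addr0; apply: cvg_trans; apply: near_eq_cvg.
  apply: filterS (near_within_dnbhs x) => z [_ nzx] /=.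
  by rewrite /diff_quotient divfK ?subr_eq0// addrC subrK.
(* From the punctured filter to the full one: at [z = x] the distance is 0. *)
apply/cvgrPdist_lt => e e0; move/cvgrPdist_lt : h => /(_ _ e0).
rewrite !near_withinE; apply: filterS => z hz Iz.
by have [->|zx] := eqVneq z x; [rewrite subrr normr0|exact: hz].
Qed.

(** The quotient of the product splits with [g] taken at [z] and [f] at [x], hence the need for
    continuity of [g]. *)
Lemma is_derive_alongM f g x l m : is_derive_along I f x l ->
  is_derive_along I g x m ->
  is_derive_along I (fun z => f z * g z) x (l * g x + f x * m).
Proof.
move=> fl gm.
have gc : g z @[z --> within I x^'] --> g x.
  apply: cvg_trans (is_derive_along_continuous gm).
  apply: cvg_app => P; rewrite /within /dnbhs /within => PI.
  rewrite /= nbhs_simpl /= in PI *; apply: filterS PI => z + _; exact.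
have : diff_quotient f x z * g z + f x * diff_quotient g x z
    @[z --> within I x^'] --> l * g x + f x * m.
  by apply: cvgD; apply: cvgM => //; exact: cvg_cst.
apply: cvg_trans; apply: near_eq_cvg; near=> z.
by rewrite /diff_quotient; ring.
Unshelve. all: by end_near. Qed.

Lemma is_derive_along_sum m n (F : nat -> R -> R) (D : nat -> R) x :
  (forall i, (m <= i < n)%N -> is_derive_along I (F i) x (D i)) ->
  is_derive_along I (fun z => \sum_(m <= i < n) F i z) x
    (\sum_(m <= i < n) D i).
Proof.
elim: n => [|n IH] FD.
  by rewrite big_geq//; under eq_fun do rewrite big_geq//;
    exact: is_derive_along_cst.
have [mn|nm] := leqP m n; last first.
  by rewrite big_geq//; under eq_fun do rewrite big_geq//;
    exact: is_derive_along_cst.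
rewrite big_nat_recr//=; under eq_fun do rewrite big_nat_recr//=.
apply: is_derive_alongD; last by apply: FD; rewrite mn ltnSn.
by apply: IH => i /andP[mi ni]; apply: FD; rewrite mi ltnW.
Qed.

(** Each Taylor weight differentiates to minus the preceding one; this is what makes the Taylor sum
    telescope. *)
Lemma is_derive_along_taylor_monomial (a x : R) n :
  is_derive_along I (fun t => (a - t) ^+ n.+1 / n.+1`!%:R) x
    (- ((a - x) ^+ n / n`!%:R)).
Proof.
have lin : is_derive_along I (fun t => a - t) x (-1).
  rewrite -[X in is_derive_along _ _ _ X]add0r.
  apply: is_derive_alongD; first exact: is_derive_along_cst.
  have -> : -%R = (fun t : R => -1 * id t) by apply/funext => t; rewrite mulN1r.
  have := is_derive_alongM (is_derive_along_cst (-1) x)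
    (is_derive_along_id x).
  by rewrite mul0r add0r mulr1.
have pow : forall k, is_derive_along I (fun t => (a - t) ^+ k.+1) x
    (- ((a - x) ^+ k *+ k.+1)).
  elim=> [|k IH]; first by rewrite expr0 mulr1n; apply: lin.
  have -> : (fun t => (a - t) ^+ k.+2) = (fun t => (a - t) * (a - t) ^+ k.+1).
    by apply/funext => t; rewrite exprS.
  have -> : - ((a - x) ^+ k.+1 *+ k.+2) =
      -1 * (a - x) ^+ k.+1 + (a - x) * - ((a - x) ^+ k *+ k.+1).
    by rewrite mulrS mulrN mulrnAr -exprS opprD mulN1r.
  exact: is_derive_alongM.
have fE : (n.+1`!%:R)^-1 = (n.+1%:R)^-1 * (n`!%:R)^-1 :> R.
  by rewrite factS natrM invfM.
have := is_derive_alongM (pow n) (is_derive_along_cst (n.+1`!%:R)^-1 x).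
rewrite fE mulr0 addr0 mulNr mulrA -[X in - (X / _ / _)]mulr_natr.
by rewrite mulfK ?pnatr_eq0.
Qed.

(** * Smoothness along a nondegenerate interval, and repeated differentiation of the equation *)

Hypotheses (I_itv : is_interval I)
  (I_nondeg : exists u v : R, [/\ I u, I v & u < v]).

Lemma derive_alongE f x l : I x -> is_derive_along I f x l ->
  derive_along I f x = l.
Proof.
move=> Ix fl; have PF := within_dnbhs_proper I_itv I_nondeg Ix.
by apply: cvg_lim => //; exact: Rhausdorff.
Qed.

Lemma derivablen_onS n f : derivablen_on I n.+1 f <->
  (forall x, I x -> derivable_along I f x) /\
  derivablen_on I n (derive_along I f).
Proof.
split=> [df|[d0 dS] [|m] mn x Ix]; last 2 first.
- exact: d0.
- by rewrite /deriven_along iterSr; exact: dS.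
split=> [x Ix|m mn x Ix]; first exact: (df 0%N).
by have := df m.+1 mn x Ix; rewrite /deriven_along iterSr.
Qed.

(** The rules for [derive_along] hold at points of [I] only, so iterating them requires replacing a
    function by one that agrees with it on [I]. *)
Lemma derivablen_on_eq n f g : (forall x, I x -> f x = g x) ->
  derivablen_on I n f -> derivablen_on I n g.
Proof.
elim: n f g => [//|n IH] f g fg /derivablen_onS[df dfn].
have H x : I x -> is_derive_along I g x (derive_along I f x).
  by move=> Ix; exact: is_derive_along_eq Ix fg (df x Ix).
apply/derivablen_onS; split=> [x Ix|].
  exact: is_derive_along_derivable (H x Ix).
by apply: IH dfn => x Ix; rewrite (derive_alongE Ix (H x Ix)).
Qed.

Lemma derivablen_on0 n : derivablen_on I n (fun=> 0 : R).
Proof.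
elim: n => [//|n IH]; apply/derivablen_onS; split=> [x Ix|].
  exact: is_derive_along_derivable (is_derive_along_cst _ _).
apply: derivablen_on_eq IH => x Ix.
by rewrite (derive_alongE Ix (is_derive_along_cst _ _)).
Qed.

Lemma derivablen_onW n f : derivablen_on I n.+1 f -> derivablen_on I n f.
Proof. by move=> df m mn; apply: df; exact: ltnW. Qed.

Lemma derivablen_onD n f g : derivablen_on I n f -> derivablen_on I n g ->
  derivablen_on I n (fun x => f x + g x).
Proof.
elim: n f g => [//|n IH] f g /derivablen_onS[df dfn] /derivablen_onS[dg dgn].
have H x : I x -> is_derive_along I (fun x => f x + g x) x
    (derive_along I f x + derive_along I g x).
  by move=> Ix; apply: is_derive_alongD; [exact: df|exact: dg].
apply/derivablen_onS; split=> [x Ix|].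
  exact: is_derive_along_derivable (H x Ix).
apply: derivablen_on_eq (IH _ _ dfn dgn) => x Ix.
by rewrite (derive_alongE Ix (H x Ix)).
Qed.

Lemma derivablen_onM n f g : derivablen_on I n f -> derivablen_on I n g ->
  derivablen_on I n (fun x => f x * g x).
Proof.
elim: n f g => [//|n IH] f g dfS dgS.
have /derivablen_onS[df dfn] := dfS; have /derivablen_onS[dg dgn] := dgS.
have H x : I x -> is_derive_along I (fun x => f x * g x) x
    (derive_along I f x * g x + f x * derive_along I g x).
  by move=> Ix; apply: is_derive_alongM; [exact: df|exact: dg].
apply/derivablen_onS; split=> [x Ix|].
  exact: is_derive_along_derivable (H x Ix).
have := derivablen_onD (IH _ _ dfn (derivablen_onW dgS))
  (IH _ _ (derivablen_onW dfS) dgn).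
by apply: derivablen_on_eq => x Ix; rewrite (derive_alongE Ix (H x Ix)).
Qed.

Lemma smooth_on_derive f : smooth_on I f -> smooth_on I (derive_along I f).
Proof. by move=> sf n; have /derivablen_onS[] := sf n.+1. Qed.

Lemma smooth_on_derivable f x : smooth_on I f -> I x ->
  is_derive_along I f x (derive_along I f x).
Proof. by move=> /(_ 1%N) df Ix; exact: (df 0%N). Qed.

Lemma smooth_on_deriven f n : smooth_on I f ->
  smooth_on I (deriven_along I n f).
Proof. by move=> sf; elim: n => //= n; exact: smooth_on_derive. Qed.

Lemma smooth_diff_coef j (p : nat -> R -> R) m i : (0 < j)%N ->
  (forall i, (1 <= i <= j.+1)%N -> smooth_on I (p i)) ->
  (1 <= i <= j.+1)%N -> smooth_on I (diff_coef I j p m i).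
Proof.
move=> j0 sp; elim: m i => [|m IH] i ij; first exact: sp.
move=> n /=; apply: derivablen_onD; last first.
  case: (ltnP i j) => [ij'|_]; last exact: derivablen_on0.
  by apply: IH; rewrite /= ltnS ltnW.
apply: derivablen_onD; first exact: smooth_on_derive (IH _ ij) n.
apply: derivablen_onM; last exact: sp.
by apply: IH.
Qed.

(** Induction on [m]. Differentiating the formula raises the order of each factor of [y] by one; the
    resulting y^(j) is eliminated by the equation and the other terms shift index, which is the
    recurrence of [diff_coef]. *)
Lemma deriven_along_diff_coef j (p : nat -> R -> R) (y : R -> R) m x :
  (0 < j)%N ->
  (forall i, (1 <= i <= j.+1)%N -> smooth_on I (p i)) -> smooth_on I y ->
  (forall x, I x -> deriven_along I j y x =
     \sum_(1 <= i < j.+1) p i x * deriven_along I (j - i) y x + p j.+1 x) ->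
  I x -> deriven_along I (j + m) y x =
    \sum_(1 <= i < j.+1) diff_coef I j p m i x * deriven_along I (j - i) y x
    + diff_coef I j p m j.+1 x.
Proof.
move=> j0 sp sy ode; elim: m x => [|m IH] x Ix.
  by rewrite addn0; exact: ode.
pose d i := diff_coef I j p m i; pose D n := deriven_along I n y.
have dd i z : (1 <= i <= j.+1)%N -> I z ->
    is_derive_along I (d i) z (derive_along I (d i) z).
  by move=> ij Iz; apply: smooth_on_derivable => //; exact: smooth_diff_coef.
have dD n z : I z -> is_derive_along I (D n) z (D n.+1 z).
  by move=> Iz; apply: smooth_on_derivable => //; exact: smooth_on_deriven.
have H : is_derive_along I (D (j + m)%N) x
    (\sum_(1 <= i < j.+1) (derive_along I (d i) x * D (j - i)%N x +
       d i x * D (j - i).+1 x) + derive_along I (d j.+1) x).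
  apply: (is_derive_along_eq (f := fun z =>
      \sum_(1 <= i < j.+1) d i z * D (j - i)%N z + d j.+1 z)) => //.
    by move=> z Iz; rewrite /D IH.
  apply: is_derive_alongD; last by apply: dd => //; rewrite /= leqnn.
  apply: is_derive_along_sum => i /andP[i0 ij].
  by apply: is_derive_alongM; [apply: dd => //; rewrite i0 ltnW|exact: dD].
rewrite addnS -[LHS]/(derive_along I (D (j + m)%N) x) (derive_alongE Ix H).
rewrite big_split /= -/(d _) ltnNge leqnSn /= addr0 -/(d 1%N).
(* The summand [i = 1] is the only one in which y^(j) appears. *)
rewrite [X in _ + X + _]big_nat_recl//=.
have -> : derive_along I (D (j - 1)%N) x = D j x.
  by rewrite -[in RHS](subnK j0) addn1.
rewrite -[D j x]/(deriven_along I j y x) ode//.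
transitivity (\sum_(1 <= i < j.+1) derive_along I (d i) x * D (j - i)%N x +
  (d 1%N x * (\sum_(1 <= i < j.+1) p i x * D (j - i)%N x) +
  \sum_(1 <= i < j.+1) (if (i < j)%N then d i.+1 x else 0) * D (j - i)%N x) +
  (derive_along I (d j.+1) x + d 1%N x * p j.+1 x)); last first.
  congr (_ + _); rewrite mulr_sumr -!big_split /=; apply: eq_big_nat => i _.
  by rewrite -/(d i) -/(d i.+1) /D; ring.
(* The [if] kills the summand [i = j]; in the others, [D (j - i)] is the derivative of
   [D (j - i.+1)]. *)
suff -> : \sum_(1 <= i < j.+1)
      (if (i < j)%N then d i.+1 x else 0) * D (j - i)%N x
    = \sum_(1 <= i < j) d i.+1 x * derive_along I (D (j - i.+1)%N) x.
  by rewrite mulrDr; ring.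
rewrite big_nat_recr//= ltnn mul0r addr0; apply: eq_big_nat => i /andP[_ ij].
by rewrite ij -(subnSK ij).
Qed.

End DeriveAlong.

(** * Fundamental theorem of calculus and Taylor expansion with integral remainder *)

Section Taylor.
Set Implicit Arguments.
Unset Strict Implicit.
Variables (R : realType) (I : set R).

(** Near an interior point, membership in [I] is no restriction; the substitution [z = h + x] then
    gives the usual derivative. *)
Lemma is_derive_along_interior (f : R -> R) (x l : R) : nbhs x I ->
  is_derive_along I f x l -> is_derive x 1 f l.
Proof.
move=> xI fl.
have sh : h + x @[h --> (0 : R)^'] --> within I x^'.
  have sx : h + x @[h --> (0 : R)] --> x.
    rewrite -[X in _ --> X]add0r.
    by apply: cvgD; [exact: cvg_id|exact: cvg_cst].
  move=> P; rewrite /within /dnbhs /within => PI.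
  have {}PI : nbhs x (fun z => z != x -> I z -> P z) := PI.
  have PIx := sx _ (filterI PI xI).
  change (\forall h \near (0 : R), h != 0 -> P (h + x)).
  near=> h => h0.
  have [] : (h + x != x -> I (h + x) -> P (h + x)) /\ I (h + x).
    by near: h; exact: PIx.
  by move=> + Ih; apply => //; rewrite -subr_eq0 addrK.
have df : h^-1 *: ((f \o shift x) (h *: (1 : R)) - f x)
    @[h --> (0 : R)^'] --> l.
  apply: cvg_trans (cvg_comp _ _ sh fl); apply: near_eq_cvg; near=> h.
  by rewrite /diff_quotient /= addrK [h *: 1]mulr1 [LHS]mulrC.
by apply: DeriveDef; [exact: (cvgP l)|exact: cvg_lim].
Unshelve. all: by end_near. Qed.

Hypothesis I_itv : is_interval I.

(** Reduction to [continuous_FTC2]: inside []a, b[] the derivative is the usual one, and at the ends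
    only one-sided continuity of [F] is required. *)
Lemma Rintegral_is_derive_along (F f : R -> R) (a b : R) :
  I a -> I b -> a < b ->
  (forall t, I t -> is_derive_along I F t (f t)) ->
  (forall t, I t -> f z @[z --> within I (nbhs t)] --> f t) ->
  \int[@lebesgue_measure R]_(t in `[a, b]) f t = F b - F a.
Proof.
move=> Ia Ib ab dF cf.
have abI : `[a, b]%classic `<=` I.
  by move=> t /=; rewrite in_itv /= => tab; exact: I_itv tab.
have within_ab (g : R -> R) :
    (forall t, I t -> g z @[z --> within I (nbhs t)] --> g t) ->
    {within `[a, b], continuous g}.
  move=> cg; apply/subspace_continuousP => t /abI It.
  apply: cvg_trans (cg t It); apply: cvg_app.
  exact: within_subset.
have dFi t : t \in `]a, b[ -> is_derive t 1 F (f t).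
  move=> tab; apply: is_derive_along_interior; last first.
    by apply/dF/abI => /=; exact: subset_itv_oo_cc.
  have := near_in_itvoo tab; apply: filterS => z zab.
  by apply: abI => /=; exact: subset_itv_oo_cc.
have [_ Fa Fb] : [/\ {in `]a, b[, continuous F},
    F @ a^'+ --> F a & F @ b^'- --> F b].
  apply/(continuous_within_itvP _ ab)/within_ab => t It.
  exact: is_derive_along_continuous (dF t It).
rewrite /Rintegral (@continuous_FTC2 _ f F)//; first exact: within_ab.
  by split=> // t tab; exact: (@ex_derive _ _ _ _ _ _ _ (dFi t tab)).
by move=> t tab; rewrite derive1E (@derive_val _ _ _ _ _ _ _ (dFi t tab)).
Qed.

Lemma oriented_integral_is_derive_along (F f : R -> R) (a b : R) :
  I a -> I b ->
  (forall t, I t -> is_derive_along I F t (f t)) ->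
  (forall t, I t -> f z @[z --> within I (nbhs t)] --> f t) ->
  oriented_integral a b f = F b - F a.
Proof.
move=> Ia Ib dF cf; rewrite /oriented_integral; case: ltgtP => [ab|ba|<-].
- exact: Rintegral_is_derive_along.
- by rewrite (Rintegral_is_derive_along Ib Ia ba dF cf) opprB.
- by rewrite set_itv1 Rintegral_set1 subrr.
Qed.

Variables (y : R -> R) (y_smooth : smooth_on I y).

(** The centre is [x] and the evaluation point is [a]; below, [a] is fixed and the centre varies. *)
Definition taylor_sum (a x : R) (N : nat) : R :=
  \sum_(0 <= n < N) (a - x) ^+ n / n`!%:R * deriven_along I n y x.

Lemma is_derive_along_taylor_sum (a : R) N x : I x ->
  is_derive_along I (taylor_sum a ^~ N.+1) x
    ((a - x) ^+ N / N`!%:R * deriven_along I N.+1 y x).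
Proof.
have dy n z : I z ->
    is_derive_along I (deriven_along I n y) z (deriven_along I n.+1 y z).
  by move=> Iz; apply: smooth_on_derivable => //; exact: smooth_on_deriven.
move=> Ix; rewrite /taylor_sum; elim: N => [|N IH].
  rewrite expr0 fact0 divr1 mul1r.
  apply: is_derive_along_eq (Ix) _ (dy 0%N x Ix) => z _.
  by rewrite big_nat1 expr0 fact0 divr1 mul1r.
under eq_fun do rewrite big_nat_recr //=.
have := is_derive_alongD IH
  (is_derive_alongM (@is_derive_along_taylor_monomial _ I a x N)
    (dy N.+1 x Ix)).
(* The weight of the new term differentiates to minus the contribution left by the induction
   hypothesis. *)
by rewrite mulNr addNKr.
Qed.

Lemma taylor_remainder (a x : R) N : I a -> I x ->
  (N`!%:R)^-1 *
    oriented_integral a x (fun t => (a - t) ^+ N * deriven_along I N.+1 y t) =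
  taylor_sum a x N.+1 - y a.
Proof.
move=> Ia Ix.
have N0 : N`!%:R != 0 :> R by rewrite pnatr_eq0 -lt0n fact_gt0.
(* An antiderivative of the integrand, scaled because the factorial stands outside the integral. *)
pose F t := N`!%:R * taylor_sum a t N.+1.
rewrite (@oriented_integral_is_derive_along F)//.
- rewrite -mulrBr mulKf//; congr (_ - _).
  (* At [t = a] only the term of order 0 survives, which is [y a]. *)
  rewrite /taylor_sum big_nat_recl//= big1 ?addr0 => [|i _].
    by rewrite expr0 fact0 divr1 mul1r.
  by rewrite subrr expr0n /= !mul0r.
- move=> t It; rewrite /F.
  have := is_derive_alongM (@is_derive_along_cst _ I N`!%:R t)
    (@is_derive_along_taylor_sum a N t It).
  by rewrite mul0r add0r mulrA (mulrC _ (_ / _)) divfK.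
- move=> t It.
  have := is_derive_along_continuous (smooth_on_derivable
    (@smooth_on_deriven _ _ _ N.+1 y_smooth) It).
  apply: cvgM; apply: cvg_within_filter.
  apply: (cvg_comp (fun z => a - z) (fun w => w ^+ N));
    last exact: exprn_continuous.
  by apply: cvgB; [exact: cvg_cst|exact: cvg_id].
Qed.

Lemma cvg_taylor_sum (a x : R) : I a -> I x ->
  (n`!%:R)^-1 * oriented_integral a x
     (fun t => (a - t) ^+ n * deriven_along I n.+1 y t)
    @[n --> \oo] --> (0 : R) ->
  taylor_sum a x @ \oo --> y a.
Proof.
move=> Ia Ix; under eq_fun do rewrite taylor_remainder//.
move=> h; suff : taylor_sum a x n.+1 @[n --> \oo] --> y a by rewrite cvg_shiftS.
have : taylor_sum a x n.+1 - y a + y a @[n --> \oo] --> 0 + y a.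
  by apply: cvgD => //; exact: cvg_cst.
by rewrite add0r; under eq_fun do rewrite subrK.
Qed.

End Taylor.

(** * The linear relation between the derivatives of order below [j] *)

Lemma sum_Q_of_eq0 (R : realType) (I : set R) (I_itv : is_interval I)
    (I_nondeg : exists u v : R, [/\ I u, I v & u < v])
    (j : nat) (j_gt0 : (0 < j)%N) (p : nat -> R -> R) (y : R -> R) (a x : R) :
  smooth_on I y ->
  (forall i, (1 <= i <= j.+1)%N -> smooth_on I (p i)) ->
  (forall z, I z -> deriven_along I j y z =
     \sum_(1 <= i < j.+1) p i z * deriven_along I (j - i) y z + p j.+1 z) ->
  I a -> I x ->
  (n`!%:R)^-1 * oriented_integral a x
     (fun t => (a - t) ^+ n * deriven_along I n.+1 y t)
    @[n --> \oo] --> (0 : R) ->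
  (forall i, (1 <= i <= j.+1)%N -> cvgn (Q_partial_sum I j p a i x)) ->
  \sum_(1 <= i < j.+1) Q_of I j p a (y a) i x * deriven_along I (j - i) y x
    + Q_of I j p a (y a) j.+1 x = 0.
Proof.
move=> sy sp ode Ia Ix rem0 Qc.
pose D n := deriven_along I n y x.
pose w n : R := (-1) ^+ n * ((x - a) ^+ n / n`!%:R).
have wE n : w n = (a - x) ^+ n / n`!%:R.
  by rewrite /w mulrA -exprMn mulN1r opprB.
(* [L i] is the series part of [Q_of]; [T], the Taylor terms of order below [j], will supply its
   monomials. *)
pose L i := limn (Q_partial_sum I j p a i x).
pose T := \sum_(0 <= n < j) w n * D n.
have sum_cvg : T +
    (\sum_(1 <= i < j.+1) Q_partial_sum I j p a i x N * D (j - i)%N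
    + Q_partial_sum I j p a j.+1 x N) @[N --> \oo] -->
    T + (\sum_(1 <= i < j.+1) L i * D (j - i)%N + L j.+1).
  apply: cvgD; first exact: cvg_cst.
  apply: cvgD; last by apply: Qc; rewrite /= leqnn.
  rewrite [X in _ --> X]big_nat; under eq_cvg do rewrite big_nat.
  apply: cvg_big => [|i /andP[i0 ij]]; first exact: add_continuous.
  by apply: cvgM (cvg_cst _); apply: Qc; rewrite i0 ltnW.
have taylor_cvg := cvg_taylor_sum I_itv sy Ia Ix rem0.
(* Both sides are limits of the same sequence: for [N >= j] the Taylor sum is [T] plus the
   combination of partial sums. *)
have yaE : y a = T + (\sum_(1 <= i < j.+1) L i * D (j - i)%N + L j.+1).
  apply: cvg_unique taylor_cvg _; first exact: Rhausdorff.
  apply: cvg_trans sum_cvg; apply: near_eq_cvg; near=> N.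
  have jN : (j <= N)%N by near: N; exact: nbhs_infty_ge.
  rewrite /taylor_sum [in RHS](@big_cat_nat _ _ _ j)//=.
  congr (_ + _); first by apply: eq_bigr => n _; rewrite wE.
  rewrite /Q_partial_sum; under eq_bigr do rewrite mulr_suml.
  (* With the sum over [n] outermost, the formula for y^(n) applies term by term, with
     [m = n - j]. *)
  rewrite exchange_big_nat -big_split/=; apply: eq_big_nat => n /andP[jn _].
  rewrite -wE -[in RHS](subnKC jn).
  rewrite (@deriven_along_diff_coef _ _ _ _ _ p) ?subnKC//.
  rewrite mulrDr mulr_sumr; congr (_ + _).
  by apply: eq_bigr => i _; rewrite mulrA.
(* Reindexing by [n = j - i] matches each Taylor term with the monomial of [Q_of] at index [i]. *)
have TE : T = \sum_(1 <= i < j.+1) w (j - i)%N * D (j - i)%N.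
  rewrite big_nat_rev big_add1; apply: eq_big_nat => i /andP[_ ij].
  by rewrite add1n !subSS subKn// ltnW.
(* At index [j.+1], [Q_of] contributes [- y a]; expanded by [yaE], it cancels everything else. *)
rewrite {2}/Q_of ltnn [X in _ + (_ - X)]yaE -/(L _) {}TE.
have -> : \sum_(1 <= i < j.+1)
      Q_of I j p a (y a) i x * deriven_along I (j - i) y x
    = \sum_(1 <= i < j.+1) (L i * D (j - i)%N + w (j - i)%N * D (j - i)%N).
  by apply: eq_big_nat => i /andP[_]; rewrite ltnS /Q_of => ->; rewrite mulrDl.
by rewrite big_split /=; ring.
Unshelve. all: by end_near. Qed.

(** * Solving the relation for the highest remaining derivative *)

Theorem theorem3p1 (R : realType) (k : nat) (k_gt0 : (0 < k)%N)
    (I : set R) (I_itv : is_interval I) (I_closed : closed I)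
    (I_nondeg : exists u v : R, [/\ I u, I v & u < v])
    (a c : nat -> R)
    (a_in : forall i, (1 <= i <= k)%N -> I (a i))
    (a_inj : forall i j, (1 <= i <= k)%N -> (1 <= j <= k)%N ->
       a i = a j -> i = j)
    (p : nat -> R -> R) (y : R -> R)
    (y_sol : fvp_solution I I k p a c y)
    (y_smooth : smooth_on I y)
    (p_smooth : forall i, (1 <= i <= k.+1)%N -> smooth_on I (p i))
    (E : set R) (E_sub : E `<=` I)
    (remainder0 : forall x, E x -> forall i, (1 <= i <= k)%N ->
       (n`!%:R)^-1 * oriented_integral (a i) x
          (fun t => (a i - t) ^+ n * deriven_along I n.+1 y t)
         @[n --> \oo] --> (0 : R))
    (Q_cvg : forall x, E x -> forall i, (1 <= i <= k.+1)%N ->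
       cvgn (Q_partial_sum I k p (a k) i x))
    (Q_neq0 : forall x, E x -> forall j, (j < k)%N ->
       Q_coef I k a c p j 1 x != 0) :
  fvp_solution I E k.-1
    (fun i x => - (Q_coef I k a c p k.-1 i.+1 x / Q_coef I k a c p k.-1 1 x))
    a c y.
Proof.
case: k => [//|k] in k_gt0 a_in a_inj y_sol p_smooth remainder0 Q_cvg Q_neq0 *.
have [_ ode ya] := y_sol.
split=> [|x Ex|i /andP[i0 ik]]; first exact: y_smooth.
  have kk : (1 <= k.+1 <= k.+1)%N by rewrite /= leqnn.
  have := @sum_Q_of_eq0 _ _ I_itv I_nondeg _ k_gt0 _ _ _ _ y_smooth p_smooth ode
    (a_in _ kk) (E_sub _ Ex) (remainder0 _ Ex _ kk) (Q_cvg _ Ex).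
  (* At the top order no reduction has taken place yet, so the coefficients are [p] itself; the
     prescribed value is that of [y]. *)
  have QE i :
      Q_of I k.+1 p (a k.+1) (y (a k.+1)) i x = Q_coef I k.+1 a c p k i x.
    by rewrite /Q_coef /reduced_coef subnn ya.
  rewrite !QE; under eq_bigr do rewrite QE.
  (* The summand [i = 1] carries the derivative of order [k], with the nonzero coefficient by which
     the relation is divided. *)
  rewrite big_nat_recl//= subn1 /=; have := Q_neq0 _ Ex k (ltnSn k).
  under eq_bigr do rewrite subSS.
  move: (Q_coef _ _ _ _ _ _) => Q Q1 H.
  under [in RHS]eq_bigr do rewrite mulNr mulrAC.
  rewrite sumrN -mulr_suml -opprD -mulrDl.
  apply: (mulfI Q1); rewrite mulrN mulrCA divff// mulr1.
  by apply/eqP; rewrite -addr_eq0 addrA H.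
by apply: ya; rewrite i0 ltnW.
Qed.
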